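(* Under the standing assumptions below, assume in addition the Slater-type condition: there exists $\epsilon>0$ such that for every $s_0\in\mathcal S$, $x_0\in\mathcal X$ there is a $P$ feasible for the ex-ante lottery problem for $(x_0,s_0)$ with $\mathbb E^{a\sim P}_{s_0}\big(\sum_{t\ge0}\beta^tg^i(x(s^t),a(s^t),s_t)-\bar g^i\big)\ge\epsilon$ for all $i=1,\dots,I$. Then for every $x\in\mathcal X$, $s\in\mathcal S$, $\gamma\in\mathbb R^I_+$ there exists $\lambda^*\in\mathbb R^I_+$ attaining the infimum in $$\inf_{\lambda\in\mathbb R^I_+}\sup_{a\in\tilde{\mathcal A}(x,s)}\Big[r(x,a,s)+\sum_{i}\big(\gamma^ig^i(x,a,s)+\lambda^i(g^i(x,a,s)-\bar g^i)\big)+\beta\mathbb E_sD(\gamma+\lambda,\zeta(x,a,s),s')\Big].$$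
   Context: Setup. Let $\mathcal S$ be a finite set and $(s_t)_{t\ge0}$ a Markov chain on $\mathcal S$ with transition probabilities $\pi(s'|s)>0$ for all $s,s'\in\mathcal S$; for $s^t=(s_0,\dots,s_t)\in\mathcal S^{t+1}$ write $\pi^t(s^t|s_0)$ for its probability given $s_0$ and $\mathbb E_{s^t}$ (or $\mathbb E_{s_t}$) for expectation over future shocks given $s^t$; $\mathbb E_s$ denotes expectation over $s'\sim\pi(\cdot|s)$. Let $\mathcal A\subset\mathbb R^n$ be a finite set, $\mathcal X\subseteq\mathbb R^m$ a countable set, $\zeta:\mathcal X\times\mathcal A\times\mathcal S\to\mathcal X$, $p:\mathcal X\times\mathcal A\times\mathcal S\to\mathbb R$, $r,g^1,\dots,g^I$ bounded real functions on $\mathcal X\times\mathcal A\times\mathcal S$, $\bar g^i\in\mathbb R$, $\beta\in(0,1)$. A plan is $a=(a(s^t))_{t,s^t}$, $a(s^t)\in\mathcal A$, inducing $x(s^0)=x_0$, $x(s^{t+1})=\zeta(x(s^t),a(s^t),s_t)$. $\tilde{\mathcal A}(x,s)=\{a\in\mathcal A:p(x,a,s)\ge0\}$; $\tilde{\mathcal A}^\infty(x_0)$ is the set of plans with $a(s^t)\in\tilde{\mathcal A}(x(s^t),s_t)$ for all $t,s^t$. A plan is feasible for $(x_0,s_0)$ if it lies in $\tilde{\mathcal A}^\infty(x_0)$ and $\mathbb E_{s_t}\sum_{n\ge0}\beta^ng^i(x(s^{t+n}),a(s^{t+n}),s_{t+n})\ge\bar g^i$ for all $t,s^t,i$. Standing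 assumption: for every $(x_0,s_0)$ a feasible plan exists. Pre-action histories $h^t=(s_0,a_0,\dots,s_{t-1},a_{t-1},s_t)\in\mathcal H^t=\mathcal S^{t+1}\times\mathcal A^t$; a plan generates $h^t=(s_0,a(s^0),\dots,a(s^{t-1}),s_t)$ along $s^t$. Dual value: $\Lambda$ is the set of $(\lambda^i(h^t))_{t,h^t,i}$, $\lambda^i(h^t)\ge0$, $\sum_t\sum_{h^t}\sum_i\beta^t\lambda^i(h^t)\pi^t(s^t|s_0)<\infty$. $L(a,\lambda;\gamma,x_0,s_0)=\mathbb E_{s_0}\sum_t\beta^t\big[r(x(s^t),a(s^t),s_t)+\sum_i\gamma^ig^i(x(s^t),a(s^t),s_t)+\sum_i\lambda^i(h^t)(\sum_{n\ge0}\beta^ng^i(x(s^{t+n}),a(s^{t+n}),s_{t+n})-\bar g^i)\big]$ and $D(\gamma,x_0,s_0)=\inf_{\lambda\in\Lambda}\sup_{a\in\tilde{\mathcal A}^\infty(x_0)}L$. Ex-ante lottery problem. Give $\tilde{\mathcal A}^\infty(x_0)$ the product topology and let $\mathcal P(\tilde{\mathcal A}^\infty(x_0))$ be the set of Borel probability measures on it; a random plan $a\sim P$ is drawn independently of the shocks. $P$ is feasible for $(x_0,s_0)$ if for all $t\ge0$, all $h^t=(s_0,\tilde a_0,\dots,s_{t-1},\tilde a_{t-1},s_t)\in\mathcal H^t$ and all $i$, $\mathbb E^{a\sim P}_{s^t}\Big[\mathbf 1\{(a(s^0),\dots,a(s^{t-1}))=(\tilde a_0,\dots,\tilde a_{t-1})\}\Big(\sum_{n\ge0}\beta^ng^i(x(s^{t+n}),a(s^{t+n}),s_{t+n})-\bar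 g^i\Big)\Big]\ge0$, where $s^t$ is the shock history contained in $h^t$. *)

(* Defs.v *)
From HB Require Import structures.
From mathcomp Require Import all_boot all_order all_algebra.
From mathcomp Require Import all_classical all_reals all_analysis.

Import Order.TTheory GRing.Theory Num.Theory.
Local Open Scope ring_scope.
Local Open Scope classical_set_scope.

(* Shock histories s^t = (s_0,...,s_t) are represented as  s0 :: l  with     *)
(* l : seq S of size t; the current shock s_t is  last s0 l.                 *)
(* A plan is a function  a : seq S -> A  (a(s^t) = a (s0 :: l)).            *)

(* x(s^t) induced by plan a from x(s^0) = x0:
   x(s^{t+1}) = zeta (x(s^t)) (a(s^t)) s_t. *)
Fixpoint state_from {S A X : Type} (zeta : X -> A -> S -> X) (a : seq S -> A)
  (x : X) (pre : seq S) (c : S) (rest : seq S) : X :=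
  match rest with
  | [::] => x
  | s' :: rest' =>
      state_from zeta a (zeta x (a (rcons pre c)) c) (rcons pre c) s' rest'
  end.

Definition state {S A X : Type} (zeta : X -> A -> S -> X) (a : seq S -> A)
  (x0 : X) (h : seq S) : X :=
  match h with
  | [::] => x0
  | s :: rest => state_from zeta a x0 [::] s rest
  end.

Fixpoint pathprob {R : realType} {S : Type} (pi : S -> S -> R) (s : S)
  (l : seq S) : R :=
  match l with
  | [::] => 1
  | s' :: l' => pi s s' * pathprob pi s' l'
  end.

Definition cont {R : realType} {S A : finType} {X : Type} {I : nat}
  (pi : S -> S -> R) (beta : R) (zeta : X -> A -> S -> X)
  (g : 'I_I -> X -> A -> S -> R)
  (a : seq S -> A) (x0 : X) (s0 : S) (i : 'I_I) (l : seq S) : R :=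
  \big[+%R/0%R]_(0 <= n <oo)
    (beta ^+ n * \sum_(m : n.-tuple S)
       pathprob pi (last s0 l) m *
       g i (state zeta a x0 (s0 :: l ++ m)) (a (s0 :: l ++ m))
           (last s0 (l ++ m))).

Definition acts {S A : Type} (a : seq S -> A) (s0 : S) (l : seq S) : seq A :=
  [seq a (s0 :: take k l) | k <- iota 0 (size l)].

Definition tAinf {R : realType} {S A X : Type} (zeta : X -> A -> S -> X)
  (p : X -> A -> S -> R) (x0 : X) (s0 : S) : set (seq S -> A) :=
  [set a | forall l : seq S,
     0 <= p (state zeta a x0 (s0 :: l)) (a (s0 :: l)) (last s0 l)].

Definition feasible_plan {R : realType} {S A : finType} {X : Type} {I : nat}
  (pi : S -> S -> R) (beta : R) (zeta : X -> A -> S -> X)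
  (p : X -> A -> S -> R) (g : 'I_I -> X -> A -> S -> R) (gbar : 'I_I -> R)
  (x0 : X) (s0 : S) (a : seq S -> A) : Prop :=
  tAinf zeta p x0 s0 a /\
  forall (l : seq S) (i : 'I_I), gbar i <= cont pi beta zeta g a x0 s0 i l.

(* Multipliers lambda^i(h^t); a pre-action history h^t is represented by
   its shock history (s_0,...,s_t) and its action history (a_0,...,a_{t-1}). *)
Definition Lambda {R : realType} {S : finType} (A : finType) (I : nat)
  (pi : S -> S -> R) (beta : R) (s0 : S)
  : set ('I_I -> seq S -> seq A -> R) :=
  [set lam | (forall i h u, 0 <= lam i h u) /\
     (\sum_(t <oo)
        (beta ^+ t * \sum_(l : t.-tuple S) \sum_(u : t.-tuple A)
            \sum_(i < I) lam i (s0 :: l) (tval u) * pathprob pi s0 l)%:E < +oo)%E].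

Definition Lagr {R : realType} {S A : finType} {X : Type} {I : nat}
  (pi : S -> S -> R) (beta : R) (zeta : X -> A -> S -> X)
  (r : X -> A -> S -> R) (g : 'I_I -> X -> A -> S -> R) (gbar : 'I_I -> R)
  (a : seq S -> A) (lam : 'I_I -> seq S -> seq A -> R) (gam : 'I_I -> R)
  (x0 : X) (s0 : S) : R :=
  \big[+%R/0%R]_(0 <= t <oo)
    (beta ^+ t * \sum_(l : t.-tuple S)
       pathprob pi s0 l *
       (r (state zeta a x0 (s0 :: l)) (a (s0 :: l)) (last s0 l)
        + \sum_(i < I) gam i * g i (state zeta a x0 (s0 :: l)) (a (s0 :: l))
                                   (last s0 l)
        + \sum_(i < I) lam i (s0 :: l) (acts a s0 l) *
              (cont pi beta zeta g a x0 s0 i l - gbar i))).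

Definition Dval {R : realType} {S A : finType} {X : Type} {I : nat}
  (pi : S -> S -> R) (beta : R) (zeta : X -> A -> S -> X)
  (p r : X -> A -> S -> R) (g : 'I_I -> X -> A -> S -> R) (gbar : 'I_I -> R)
  (gam : 'I_I -> R) (x0 : X) (s0 : S) : \bar R :=
  ereal_inf [set ereal_sup [set (Lagr pi beta zeta r g gbar a lam gam x0 s0)%:E
                           | a in tAinf zeta p x0 s0]
            | lam in Lambda A I pi beta s0].

(* plan space; the default action a0 only serves to make the type pointed *)
Definition planT (S : Type) {A : Type} (a0 : A) := seq S -> A.
HB.instance Definition _ (S : Type) (A : choiceType) (a0 : A) :=
  Choice.on (planT S a0).
HB.instance Definition _ (S : Type) (A : choiceType) (a0 : A) :=
  isPointed.Build (planT S a0) (fun _ => a0).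

(* cylinder sets generating the product (= Borel, as the space of plans is a
   countable product of finite discrete spaces) sigma-algebra *)
Definition cyl (S : Type) {A : Type} (a0 : A) : set (set (planT S a0)) :=
  range (fun hb : seq S * A => [set a : planT S a0 | a hb.1 = hb.2]).

Definition planM (S : Type) {A : choiceType} (a0 : A) := g_sigma_algebraType (cyl S a0).

Definition lottery_feasible {R : realType} {S A : finType} {X : Type} {I : nat}
  (pi : S -> S -> R) (beta : R) (zeta : X -> A -> S -> X)
  (p : X -> A -> S -> R) (g : 'I_I -> X -> A -> S -> R) (gbar : 'I_I -> R)
  (a0 : A) (P : probability (planM S a0) R) (x0 : X) (s0 : S) : Prop :=
  P (tAinf zeta p x0 s0) = 1%E /\
  forall (l : seq S) (u : seq A) (i : 'I_I), size u = size l ->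
    (0 <= \int[P]_(a in [set a : planM S a0 | acts a s0 l = u])
             (cont pi beta zeta g a x0 s0 i l - gbar i)%:E)%E.

Definition Phi {R : realType} {S A : finType} {X : Type} {I : nat}
  (pi : S -> S -> R) (beta : R) (zeta : X -> A -> S -> X)
  (p r : X -> A -> S -> R) (g : 'I_I -> X -> A -> S -> R) (gbar : 'I_I -> R)
  (gam lam : 'I_I -> R) (x : X) (s : S) : \bar R :=
  ereal_sup [set ((r x a s + \sum_(i < I) (gam i * g i x a s
                                        + lam i * (g i x a s - gbar i)))%:E
                 + beta%:E * \sum_(s' : S) ((pi s s')%:E *
                     Dval pi beta zeta p r g gbar (fun i => (gam i + lam i)%R)
                          (zeta x a s) s'))%E
            | a in [set a : A | 0 <= p x a s]].

(* Main.v *)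
(** The dual value is finite and Lipschitz in [gam], because the Lagrangian
    depends on [gam] only through [\sum_i gam_i J_i(a)], where the discounted
    values [J_i] are uniformly bounded. So [Phi] is Lipschitz in [lam], and it
    attains its infimum on the closed orthant as soon as it is coercive there.

    Coercivity comes from weak duality against the Slater lottery [P] at [(x, s)].
    Choose near-optimal multipliers for every continuation dual value
    [D(gam + lam, zeta x b s, s')]. For an admissible plan [a], evaluating these
    Lagrangians at the continuation of [a] bounds [Phi] below by
    [- const + \sum_i lam_i (J_i(a) - gbar_i)] plus the continuation penalties of
    [a]. Integrate against [P]: feasibility of the lottery makes the penalties
    nonnegative in expectation, and the Slater condition gives
    [Phi >= - const + eps * \sum_i lam_i]. The penalty series is first truncated,
    with a tail that is small uniformly in [a], so that only finite sums are
    integrated. *)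

Require Import Defs.
From HB Require Import structures.
From mathcomp Require Import all_boot all_order all_algebra.
From mathcomp Require Import all_classical all_reals all_analysis.
From mathcomp Require Import measurable_realfun ring lra.

Import Order.TTheory GRing.Theory Num.Theory.
Import numFieldNormedType.Exports.
Local Open Scope ring_scope.
Local Open Scope classical_set_scope.

(** * Real series: domination, shift, finite sums and tails *)

Section series_lemmas.
Context {R : realType}.
Implicit Types f v : R ^nat.

Lemma dominated_series_cvg f v :
  (forall n, `|f n| <= v n) -> cvgn (series v) -> cvgn (series f).
Proof.
move=> fv cv; apply: normed_cvg; apply: (series_le_cvg _ _ fv cv) => n //.
exact: le_trans (fv n).
Qed.

Lemma dominated_series_le f v :
  (forall n, `|f n| <= v n) -> cvgn (series v) ->
  `|limn (series f)| <= limn (series v).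
Proof.
move=> fv cv.
have cnf : cvgn [normed series f].
  by apply: (series_le_cvg _ _ fv cv) => n //; exact: le_trans (fv n).
by apply: (le_trans (lim_series_norm cnf)); exact: lim_series_le.
Qed.

Lemma series_recl f : cvgn (series f) ->
  cvgn (series (fun n => f n.+1)) /\
  limn (series f) = f 0%N + limn (series (fun n => f n.+1)).
Proof.
move=> cf.
have E n : series (fun n => f n.+1) n = series f n.+1 - f 0%N.
  by rewrite /series /= big_nat_recl// addrC addKr.
have h : series (fun n => f n.+1) n @[n --> \oo] --> limn (series f) - f 0%N.
  under eq_fun do rewrite E.
  by apply: cvgB; [rewrite (cvg_shiftS (series f)); exact: cf|exact: cvg_cst].
by split; [apply/cvg_ex; eexists; exact: h|rewrite (cvg_lim _ h)// addrC subrK].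
Qed.

Lemma series_sum_cvg (J : finType) (F : J -> R ^nat) :
  (forall j, cvgn (series (F j))) ->
  cvgn (series (fun n => \sum_j F j n)) /\
  limn (series (fun n => \sum_j F j n)) = \sum_j limn (series (F j)).
Proof.
move=> cF.
have h : series (fun n => \sum_j F j n) n @[n --> \oo] -->
         \sum_j limn (series (F j)).
  have -> : series (fun n => \sum_j F j n) =
            (fun n => \sum_j series (F j) n).
    by apply/funext => n; rewrite /series /= exchange_big.
  elim: (index_enum J) => [|j s ih].
    by under eq_fun do rewrite big_nil; rewrite big_nil; exact: cvg_cst.
  by under eq_fun do rewrite big_cons; rewrite big_cons; apply: cvgD ih; exact: cF.
by split; [apply/cvg_ex; eexists; exact: h|exact: cvg_lim].
Qed.

Lemma seriesZl_cvg (c : R) f : cvgn (series f) ->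
  cvgn (series (fun n => c * f n)) /\
  limn (series (fun n => c * f n)) = c * limn (series f).
Proof. by move=> cf; split; [exact: is_cvg_seriesZ|exact: lim_seriesZ]. Qed.

Lemma geometric_bound_cvg (z C : R) : 0 < z < 1 ->
  cvgn (series (fun n => z ^+ n * C)) /\
  limn (series (fun n => z ^+ n * C)) = C / (1 - z).
Proof.
move=> /andP[z0 z1].
have -> : (fun n => z ^+ n * C) = geometric C z.
  by apply/funext => n /=; rewrite mulrC.
have zn : `|z| < 1 by rewrite ger0_norm// ltW.
split; first exact: is_cvg_geometric_series.
by apply/cvg_lim => //; exact: cvg_geometric_series.
Qed.

(** The terms of [f + v] are nonnegative, so its partial sums stay below its limit; splitting that
    limit bounds the loss from truncating [f] at [T] by the tail of [v]. *)
Lemma dominated_series_tail f v T :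
  (forall n, `|f n| <= v n) -> cvgn (series v) ->
  series f T - (limn (series v) - series v T) <= limn (series f).
Proof.
move=> fv cv; have cf := dominated_series_cvg f v fv cv.
rewrite opprB addrA lerBlDr -lim_seriesD//.
have -> : series f T + series v T = series (f + v) T by rewrite seriesD.
apply: nondecreasing_cvgn_le; last exact: is_cvg_seriesD.
apply: nondecreasing_series => n _ _; rewrite !fctE -lerBlDr sub0r.
by have := fv n; rewrite ler_norml => /andP[].
Qed.

End series_lemmas.

(** * Sums over shock histories of fixed length *)

Lemma sum_tuple0 {R : realType} (T : finType) (F : seq T -> R) :
  \sum_(m : 0.-tuple T) F m = F [::].
Proof.
by rewrite (big_pred1 [tuple])// => m; rewrite (tuple0 m); exact/esym/eqP.
Qed.

Lemma sum_tupleS {R : realType} (T : finType) n (F : seq T -> R) :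
  \sum_(m : n.+1.-tuple T) F m = \sum_(c : T) \sum_(m : n.-tuple T) F (c :: m).
Proof.
rewrite pair_big /=.
rewrite (reindex (fun q : T * n.-tuple T => [tuple of q.1 :: q.2])) //=.
exists (fun m => (thead m, [tuple of behead m])) => [[c m] _|m _] /=.
  by congr pair; apply: val_inj.
by rewrite [RHS]tuple_eta.
Qed.

(** * Continuation plans and dependence on finitely many histories *)

Section plans.
Context {S A X : Type} (zeta : X -> A -> S -> X).
Implicit Types (a : seq S -> A) (s : S) (x : X).

Definition continuation a s : seq S -> A := fun h => a (s :: h).

Lemma state_from_continuation a s x pre c rest :
  state_from zeta a x (s :: pre) c rest =
  state_from zeta (continuation a s) x pre c rest.
Proof. by elim: rest x pre c => //= s' rest ih x pre c; rewrite -ih. Qed.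

Lemma state_continuation a x s s' l :
  state zeta a x (s :: s' :: l) =
  state zeta (continuation a s) (zeta x (a [:: s]) s) (s' :: l).
Proof. exact: state_from_continuation. Qed.

Lemma acts_continuation a s s' l :
  acts a s (s' :: l) = a [:: s] :: acts (continuation a s) s' l.
Proof.
by rewrite /acts /= (iotaDl 1 0) -map_comp.
Qed.

Lemma tAinf_continuation (R : realType) (p : X -> A -> S -> R) a x s s' :
  tAinf zeta p x s a ->
  tAinf zeta p (zeta x (a [:: s]) s) s' (continuation a s).
Proof. by move=> h l; have := h (s' :: l); rewrite state_continuation. Qed.

(** The length counts the initial shock, so histories of length [n] belong to time [n - 1].
    Quantities that respect [agree n] read finitely many values of the plan, which makes them
    measurable. *)
Definition agree n a a' := forall h, (size h <= n)%N -> a h = a' h.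

Lemma eq_state_from n a a' x pre c rest : agree n a a' ->
  (size pre + size rest <= n)%N ->
  state_from zeta a x pre c rest = state_from zeta a' x pre c rest.
Proof.
move=> h; elim: rest x pre c => //= s' rest ih x pre c le_n.
rewrite h ?size_rcons; last by rewrite (leq_trans _ le_n)// addnS ltnS leq_addr.
by apply: ih; rewrite size_rcons addSn -addnS.
Qed.

Lemma eq_state n a a' x s l : agree n a a' -> (size l <= n)%N ->
  state zeta a x (s :: l) = state zeta a' x (s :: l).
Proof. by move=> h le_n; exact: eq_state_from h _. Qed.

Lemma eq_acts n a a' s l : agree n a a' -> (size l <= n)%N ->
  acts a s l = acts a' s l.
Proof.
move=> h le_n; apply/eq_in_map => k; rewrite mem_iota add0n => /= k_l.
by apply: h; rewrite /= size_take k_l (leq_trans k_l).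
Qed.

Lemma size_acts a s l : size (acts a s l) = size l.
Proof. by rewrite size_map size_iota. Qed.

End plans.

(** * Measurability on the space of plans *)

Section plan_measurability.
Context {R : realType} {S A : finType} (a0 : A).

Lemma measurable_plan_values (hs : seq (seq S)) (u : seq A) :
  measurable [set a : planM S a0 | map a hs = u].
Proof.
elim: hs u => [|h hs ih] [|b u] /=.
- by rewrite (_ : [set _ | _] = setT)//; apply/seteqP; split.
- by rewrite (_ : [set _ | _] = set0)//; apply/seteqP; split.
- by rewrite (_ : [set _ | _] = set0)//; apply/seteqP; split.
rewrite (_ : [set _ | _] = [set a : planM S a0 | a h = b] `&`
                           [set a : planM S a0 | map a hs = u]).
  apply: measurableI; last exact: ih.
  by apply: sub_sigma_algebra; exists (h, b).
by apply/seteqP; split => a /= => [[-> ->]|[-> ->]].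
Qed.

(** There are finitely many histories of length at most [n] and finitely many actions, so [D] is a
    finite union of sets that prescribe the plan on all these histories. *)
Lemma measurable_determined_set n (D : set (planM S a0)) :
  (forall a a' : planM S a0, agree n a a' -> D a -> D a') -> measurable D.
Proof.
move=> detD.
pose hs : seq (seq S) :=
  flatten [seq [seq tval m | m : k.-tuple S] | k <- iota 0 n.+1].
have mem_hs h : (size h <= n)%N -> h \in hs.
  move=> h_n; apply/flattenP; exists [seq tval m | m : (size h).-tuple S].
    by apply/mapP; exists (size h) => //; rewrite mem_iota.
  by apply/mapP; exists (in_tuple h) => //; rewrite mem_enum.
have -> : D = \bigcup_(u in [set u : (size hs).-tuple A |
                  exists2 a : planM S a0, D a & map a hs = u])
              [set a : planM S a0 | map a hs = tval u].
  apply/seteqP; split => [a Da|a [u [a' Da' a'u]]] /=.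
    exists (Tuple (introT eqP (size_map a hs))) => //=.
    by exists a.
  rewrite -a'u => /esym/eq_in_map a'a.
  by apply: detD Da' => h /mem_hs; exact: a'a.
apply: fin_bigcup_measurable; first exact: finite_finset.
by move=> u _; exact: measurable_plan_values.
Qed.

Lemma measurable_determined_fun n (f : planM S a0 -> R) :
  (forall a a' : planM S a0, agree n a a' -> f a = f a') ->
  measurable_fun setT f.
Proof.
move=> detf _ Y mY; rewrite setTI; apply: (@measurable_determined_set n).
by move=> a a' /detf; rewrite /preimage /= => ->.
Qed.

Lemma measurable_acts s l u :
  measurable [set a : planM S a0 | acts a s l = u].
Proof.
apply: (@measurable_determined_set (size l)) => a a' aa' /= <-.
by apply/esym; exact: eq_acts aa' _.
Qed.

(** Shock histories are countably many, and each admissibility constraint reads finitely many values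
    of the plan. *)
Lemma measurable_tAinf (X : Type) (zeta : X -> A -> S -> X)
    (p : X -> A -> S -> R) x s :
  measurable (tAinf zeta p x s : set (planM S a0)).
Proof.
pose D (l : seq S) : set (planM S a0) :=
  [set a | ~~ (0 <= p (state zeta a x (s :: l)) (a (s :: l)) (last s l))].
have -> : (tAinf zeta p x s : set (planM S a0)) = ~` (\bigcup_l D l).
  rewrite setC_bigcup; apply/seteqP; split => a h l => [_|].
    by rewrite /D /= h.
  by have := h l I; rewrite /D /=; case: (0 <= _) => // /(_ isT).
apply: measurableC; apply: countable_bigcupT_measurable.
  exact: countableP.
move=> l; apply: (@measurable_determined_set (size l).+1) => a a' aa'.
rewrite /D /mkset (eq_state _ (size l).+1 _ _ _ _ _ aa')//.
by rewrite (aa' (s :: l)).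
Qed.

End plan_measurability.

(** * Lower bounds on expectations *)

Section expectation_lower_bound.
Context {d} {T : measurableType d} {R : realType} (P : probability T R).
Implicit Types (c k : R) (F G : T -> R).

(** Integrability is bundled with the bound, so that bounds can be combined linearly without
    separate side conditions. *)
Definition expect_ge c F :=
  P.-integrable setT (EFin \o F) /\ (c%:E <= \int[P]_a (F a)%:E)%E.

Lemma bounded_probability_integrable F B : measurable_fun setT F ->
  (forall a, `|F a| <= B) -> P.-integrable setT (EFin \o F).
Proof.
move=> mF FB; apply: measurable_bounded_integrable => //.
  by rewrite (le_lt_trans (probability_le1 P _))// ltry.
exists B; split; first exact: num_real.
by move=> b Bb a _; apply: (le_trans (FB a)); exact: ltW.
Qed.

Lemma expect_geD c c' F G : expect_ge c F -> expect_ge c' G ->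
  expect_ge (c + c') (fun a => F a + G a).
Proof.
move=> [iF hF] [iG hG]; split.
  by rewrite (_ : _ \o _ = (EFin \o F) \+ (EFin \o G))//; exact: integrableD.
by rewrite integralD_EFin// EFinD leeD.
Qed.

Lemma expect_geZ c k F : 0 <= k -> expect_ge c F ->
  expect_ge (k * c) (fun a => k * F a).
Proof.
move=> k0 [iF hF]; split.
  rewrite (_ : _ \o _ = (fun a => k%:E * (EFin \o F) a)%E)//.
  exact: integrableZl.
under eq_integral do rewrite EFinM.
by rewrite integralZl// EFinM lee_wpmul2l.
Qed.

Lemma expect_ge_sum (J : Type) (s : seq J) (c : J -> R) (F : J -> T -> R) :
  (forall j, expect_ge (c j) (F j)) ->
  expect_ge (\sum_(j <- s) c j) (fun a => \sum_(j <- s) F j a).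
Proof.
move=> h; elim: s => [|j s ih].
  rewrite big_nil; under eq_fun do rewrite big_nil.
  by split; [exact: integrable0|rewrite integral0].
rewrite big_cons (_ : (fun a => _) = (fun a => F j a + \sum_(j <- s) F j a)).
  exact: expect_geD.
by apply/funext => a; rewrite big_cons.
Qed.

Lemma expect_ge0_sum (J : Type) (s : seq J) (F : J -> T -> R) :
  (forall j, expect_ge 0 (F j)) ->
  expect_ge 0 (fun a => \sum_(j <- s) F j a).
Proof.
by move=> h; have := expect_ge_sum J s (fun=> 0) F h; rewrite big1.
Qed.

Lemma expect_ge0Z k F : 0 <= k -> expect_ge 0 F ->
  expect_ge 0 (fun a => k * F a).
Proof. by move=> k0 /(expect_geZ _ _ _ k0); rewrite mulr0. Qed.

(** The complement of [D] is null, so the integral of [F] may be taken over [D], where [b]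
    dominates. The set [D] will be that of the admissible plans. *)
Lemma expect_ge_le c b F (D : set T) : measurable D -> P D = 1%E ->
  expect_ge c F -> (forall a, D a -> F a <= b) -> c <= b.
Proof.
move=> mD PD [iF cF] Fb; rewrite -lee_fin (le_trans cF)//.
have PD0 : P (~` D) = 0%E by rewrite probability_setC// PD subee.
rewrite (negligible_integral (measurableC mD) _ iF PD0)//.
rewrite setDE setCK setTI.
apply: (@le_trans _ _ (\int[P]_(a in D) b%:E)%E).
  apply: le_integral => //.
  - exact: integrableS iF.
  - by apply: finite_measure_integrable_cst.
  - by move=> a /set_mem Da; rewrite lee_fin Fb.
by rewrite integral_cst// [X in (_ * X)%E](_ : _ = 1%E) ?mule1.
Qed.

End expectation_lower_bound.

(** * Minimising a coercive Lipschitz function on the orthant *)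

Lemma lipschitz_coercive_min {R : realType} n (f : ('I_n -> R) -> R) (L c C : R) :
  0 <= L -> 0 < c ->
  (forall u v, f u <= f v + L * \sum_(i < n) `|u i - v i|) ->
  (forall u : 'I_n -> R, (forall i, 0 <= u i) -> c * \sum_(i < n) u i <= f u + C) ->
  exists u : 'I_n -> R, (forall i, 0 <= u i) /\
    forall v : 'I_n -> R, (forall i, 0 <= v i) -> f u <= f v.
Proof.
move=> L0 c0 lipf coef.
(* If some coordinate of [v] exceeds [B], coercivity gives [f v >= f 0]. Hence a minimiser over the
   compact box with sides [[0, B]], which contains 0, is a minimiser over the whole orthant. *)
pose B := (f (fun=> 0) + C) / c.
have B0 : 0 <= B.
  apply: divr_ge0; last exact: ltW.
  have := coef (fun=> 0) (fun=> lexx _).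
  by rewrite big1 ?mulr0.
pose K : set 'rV[R]_n := [set v | forall i, `[0, B]%classic (v ord0 i)].
have cK : compact K by apply: (@rV_compact _ _ (fun=> `[0, B]%classic)) => _; exact: segment_compact.
pose h (v : 'rV[R]_n) := f (v ord0).
have ch : continuous h.
  move=> v; have Fv : Filter (nbhs v) by exact: nbhs_filter.
  apply/(@cvgrPdist_le _ _ _ _ Fv) => e e0.
  (* The [+ 1] keeps the denominator positive when [L * n] vanishes. *)
  have d0 : 0 < e / (L * n%:R + 1) by rewrite divr_gt0// ltr_wpDl// mulr_ge0.
  near=> w.
  have vw i : `|v ord0 i - w ord0 i| <= e / (L * n%:R + 1).
    have bw : ball v (e / (L * n%:R + 1)) w by near: w; exact: nbhsx_ballx.
    by have := bw.2 ord0 i; rewrite -ball_normE /= => /ltW. 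
  have sum_le : L * \sum_(i < n) `|v ord0 i - w ord0 i| <= e.
    apply: (@le_trans _ _ (L * n%:R * (e / (L * n%:R + 1)))).
      rewrite -mulrA ler_wpM2l// (le_trans (ler_sum _ (fun i _ => vw i)))//.
      by rewrite sumr_const card_ord mulr_natl.
    rewrite mulrCA; apply: ler_piMr; first exact: ltW.
    rewrite ler_pdivrMr ?mul1r ?lerDl//.
    by rewrite ltr_wpDl// mulr_ge0.
  rewrite ler_norml; apply/andP; split.
    have := lipf (w ord0) (v ord0); under eq_bigr do rewrite distrC.
    by rewrite /h; move: sum_le; lra.
  by have := lipf (v ord0) (w ord0); rewrite /h; move: sum_le; lra.
have K0 : K 0 by move=> i; rewrite mxE /= in_itv /= lexx.
have Kn0 : K !=set0 by exists 0.
have [u uK minu] := compact_EVT_min Kn0 cK (continuous_subspaceT ch).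
have {}uK := set_mem uK.
exists (u ord0); split => [i|v v0].
  by have := uK i; rewrite /= in_itv /= => /andP[].
have [vB|] := pselect (forall i, v i <= B).
  have := minu (\row_i v i); rewrite /h.
  have -> : (\row_i v i) ord0 = v by apply/funext => i; rewrite mxE.
  by apply; apply/mem_set => i; rewrite mxE /= in_itv /= v0 vB.
move=> /existsNP[i /negP]; rewrite -ltNge => Bv.
have le0 : f (u ord0) <= f (fun=> 0).
  have := minu 0 (mem_set K0); rewrite /h.
  by have -> : (0 : 'rV[R]_n) ord0 = (fun=> 0) by apply/funext => j; rewrite mxE.
have : c * B <= c * \sum_(j < n) v j.
  rewrite ler_pM2l// (bigD1 i)//=; apply: ler_wpDr; last exact: ltW.
  by apply: sumr_ge0 => j _; exact: v0.
rewrite /B mulrCA divff ?gt_eqF// mulr1 => cB.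
by have := coef v v0; move: cB le0; lra.
Unshelve. all: by end_near. Qed.

Lemma ereal_inf_attained {R : realType} {T : Type} (f : T -> \bar R) (D : set T) u :
  (forall v, f v \is a fin_num) -> D u ->
  (forall v, D v -> fine (f u) <= fine (f v)) ->
  f u = ereal_inf [set f v | v in D].
Proof.
move=> ff Du umin; apply/eqP; rewrite eq_le; apply/andP; split.
  apply: le_ereal_inf_tmp => _ [v Dv <-].
  by rewrite -(fineK (ff u)) -(fineK (ff v)) lee_fin; exact: umin.
by apply: ereal_inf_lbound; exists u.
Qed.

(** * The recursive problem under a common bound [M] *)

Section recursive_contract.
Context {R : realType} {S A : finType} {X : Type} {I : nat}
  (pi : S -> S -> R) (beta : R) (zeta : X -> A -> S -> X)
  (p r : X -> A -> S -> R) (g : 'I_I -> X -> A -> S -> R) (gbar : 'I_I -> R)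
  (M : R).
Hypothesis pi_ge0 : forall s s', 0 <= pi s s'.
Hypothesis pi_sum1 : forall s, \sum_(s' : S) pi s s' = 1.
Hypothesis beta01 : 0 < beta < 1.
Hypothesis M_ge0 : 0 <= M.
Hypothesis r_bdd : forall y b c, `|r y b c| <= M.
Hypothesis g_bdd : forall i y b c, `|g i y b c| <= M.
Hypothesis gbar_bdd : forall i, `|gbar i| <= M.
Implicit Types (f : X -> A -> S -> R) (phi psi : seq S -> R)
  (a : seq S -> A) (x : X) (s : S) (b : A) (gam : 'I_I -> R).

Local Notation Lagr := (Lagr pi beta zeta r g gbar).
Local Notation Dval := (Dval pi beta zeta p r g gbar).
Local Notation Phi := (Phi pi beta zeta p r g gbar).
Local Notation Lambda := (Lambda A I pi beta).

Let beta_ge0 : 0 <= beta. Proof. by case/andP: beta01 => /ltW. Qed.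
(** The geometric-series bound on discounted sums of payoffs bounded by [M]. *)
Let N := M / (1 - beta).
Let N_ge0 : 0 <= N.
Proof. by rewrite divr_ge0// subr_ge0; case/andP: beta01 => _ /ltW. Qed.

(** * Expectation over the next [n] shocks *)

Definition shockE n s phi : R := \sum_(m : n.-tuple S) pathprob pi s m * phi m.

Lemma pathprob_ge0 s l : 0 <= pathprob pi s l.
Proof. by elim: l s => //= s' l ih s; rewrite mulr_ge0. Qed.

Lemma shockE0 s phi : shockE 0 s phi = phi [::].
Proof.
by rewrite /shockE (sum_tuple0 _ (fun m => pathprob pi s m * phi m)) mul1r.
Qed.

Lemma shockES n s phi : shockE n.+1 s phi =
  \sum_(s' : S) pi s s' * shockE n s' (fun l => phi (s' :: l)).
Proof.
rewrite /shockE (sum_tupleS _ _ (fun m => pathprob pi s m * phi m)).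
apply: eq_bigr => s' _; rewrite mulr_sumr; apply: eq_bigr => m _ /=.
by rewrite mulrA.
Qed.

Lemma shockE_cst n s c : shockE n s (fun=> c) = c.
Proof.
elim: n s => [|n ih] s; first by rewrite shockE0.
by rewrite shockES; under eq_bigr do rewrite ih; rewrite -mulr_suml pi_sum1 mul1r.
Qed.

Lemma ler_shockE n s phi psi : (forall l, size l = n -> phi l <= psi l) ->
  shockE n s phi <= shockE n s psi.
Proof.
move=> h; apply: ler_sum => m _; apply: ler_wpM2l; first exact: pathprob_ge0.
by apply: h; rewrite size_tuple.
Qed.

Lemma ler_norm_shockE n s phi :
  `|shockE n s phi| <= shockE n s (fun l => `|phi l|).
Proof.
apply: (le_trans (ler_norm_sum _ _ _)); apply: ler_sum => m _.
by rewrite normrM ger0_norm ?pathprob_ge0.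
Qed.

Lemma shockE_bound n s phi C : (forall l, `|phi l| <= C) ->
  `|shockE n s phi| <= C.
Proof.
move=> h; apply: (le_trans (ler_norm_shockE _ _ _)).
by rewrite -[leRHS](shockE_cst n s); exact: ler_shockE.
Qed.

Lemma eq_shockE n s phi psi : (forall l, size l = n -> phi l = psi l) ->
  shockE n s phi = shockE n s psi.
Proof. by move=> h; apply: eq_bigr => m _; rewrite h// size_tuple. Qed.

Lemma shockED n s phi psi :
  shockE n s (fun l => phi l + psi l) = shockE n s phi + shockE n s psi.
Proof. by rewrite /shockE -big_split; apply: eq_bigr => m _; rewrite mulrDr. Qed.

Lemma shockEZ n s c phi : shockE n s (fun l => c * phi l) = c * shockE n s phi.
Proof. by rewrite /shockE mulr_sumr; apply: eq_bigr => m _; rewrite mulrCA. Qed.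

Lemma shockE_sum (J : finType) n s (phi : J -> seq S -> R) :
  shockE n s (fun l => \sum_j phi j l) = \sum_j shockE n s (phi j).
Proof.
by rewrite /shockE exchange_big; apply: eq_bigr => m _; rewrite mulr_sumr.
Qed.

(** * Discounted values along a plan *)

Definition disc_term f a x s l n : R :=
  beta ^+ n * shockE n (last s l) (fun m =>
    f (state zeta a x (s :: l ++ m)) (a (s :: l ++ m)) (last s (l ++ m))).

(** [disc (g i)] unfolds to [cont]; a general [f] covers [r] as well. *)
Definition disc f a x s l : R := limn (series (disc_term f a x s l)).

Section discounted_value.
Variables (f : X -> A -> S -> R) (B : R).
Hypothesis f_bdd : forall y b c, `|f y b c| <= B.

Lemma disc_term_bound a x s l n : `|disc_term f a x s l n| <= beta ^+ n * B.
Proof.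
have /andP[/ltW b0 _] := beta01.
rewrite normrM ger0_norm ?exprn_ge0//; apply: ler_wpM2l; rewrite ?exprn_ge0//.
exact: shockE_bound.
Qed.

Lemma disc_cvg a x s l : cvgn (series (disc_term f a x s l)).
Proof.
exact: dominated_series_cvg (disc_term_bound a x s l)
  (geometric_bound_cvg _ _ beta01).1.
Qed.

Lemma disc_bound a x s l : `|disc f a x s l| <= B / (1 - beta).
Proof.
have [cv <-] := geometric_bound_cvg beta B beta01.
exact: dominated_series_le (disc_term_bound a x s l) cv.
Qed.

Lemma disc_continuation a x s s' l :
  disc f a x s (s' :: l) =
  disc f (continuation a s) (zeta x (a [:: s]) s) s' l.
Proof.
rewrite /disc; congr (limn (series _)); apply/funext => n; rewrite /disc_term.
congr (_ * _); apply: eq_shockE => m _.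
by rewrite !cat_cons state_continuation.
Qed.

(** Split off the current term, condition the later ones on the next shock, and exchange the finite
    sum over that shock with the series. *)
Lemma disc_rec a x s :
  disc f a x s [::] = f x (a [:: s]) s + beta * \sum_(s' : S) pi s s' *
    disc f (continuation a s) (zeta x (a [:: s]) s) s' [::].
Proof.
rewrite /disc (series_recl _ (disc_cvg a x s [::])).2; congr (_ + _).
  by rewrite /disc_term shockE0 expr0 mul1r.
pose F s' := disc_term f (continuation a s) (zeta x (a [:: s]) s) s' [::].
have cF s' : cvgn (series (fun n => pi s s' * F s' n)) /\
    limn (series (fun n => pi s s' * F s' n)) = pi s s' * limn (series (F s')).
  by apply: seriesZl_cvg; exact: disc_cvg.
under [in RHS]eq_bigr do rewrite -(cF _).2.
have [cS <-] := series_sum_cvg _ (fun s' n => pi s s' * F s' n)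
  (fun s' => (cF s').1).
have [_ <-] := seriesZl_cvg beta _ cS.
congr (limn (series _)); apply/funext => n.
rewrite /F /disc_term shockES exprS mulr_sumr mulr_sumr; apply: eq_bigr => s' _.
rewrite -!mulrA; congr (_ * _).
rewrite mulrCA; congr (_ * (_ * _)).
by apply: eq_shockE => m _; rewrite !cat0s state_continuation.
Qed.

Lemma measurable_disc (a0 : A) x s l :
  measurable_fun setT (fun a : planM S a0 => disc f a x s l).
Proof.
apply: (@measurable_fun_cvg _ _ _ _ (fun n (a : planM S a0) =>
  series (disc_term f a x s l) n)); last by move=> a _; exact: disc_cvg.
(* The limit is pointwise, and each partial sum reads finitely many histories; the successor
   accounts for the initial shock [s]. *)
move=> n; apply: (@measurable_determined_fun _ _ _ a0 (size l + n).+1).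
move=> a a' aa'; apply: eq_big_nat => k /andP[_ kn].
rewrite /disc_term; congr (_ * _); apply: eq_shockE => m mk.
have le_n : (size (l ++ m) <= (size l + n))%N.
  by rewrite size_cat mk leq_add2l ltnW.
by rewrite (eq_state _ _ _ _ _ _ _ aa') ?(leq_trans le_n)// aa'.
Qed.

End discounted_value.

(** * The Lagrangian and the dual value *)

Section dual_value.
Implicit Types lam : 'I_I -> seq S -> seq A -> R.

Let disc_r a x s l : `|disc r a x s l| <= N.
Proof. exact: disc_bound. Qed.

Let disc_g i a x s l : `|disc (g i) a x s l| <= N.
Proof. exact: disc_bound. Qed.

Lemma slack_bound i a x s l : `|disc (g i) a x s l - gbar i| <= N + M.
Proof. by rewrite (le_trans (ler_normB _ _))// lerD. Qed.

(** The time-[t] term of the summability condition in [Lambda], as a real number. *)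
Definition weight lam s t : R := beta ^+ t *
  \sum_(l : t.-tuple S) \sum_(u : t.-tuple A) \sum_(i < I)
    lam i (s :: l) (tval u) * pathprob pi s l.

Lemma weight_ge0 lam s t : (forall i h u, 0 <= lam i h u) -> 0 <= weight lam s t.
Proof.
move=> lam0; rewrite mulr_ge0 ?exprn_ge0//.
do 3 (apply: sumr_ge0 => ? _).
by rewrite mulr_ge0 ?pathprob_ge0.
Qed.

Lemma weight_cvg lam s : Lambda s lam -> cvgn (series (weight lam s)).
Proof.
move=> [lam0 lam_oo].
have w0 n : 0 <= weight lam s n by exact: weight_ge0.
apply: nondecreasing_is_cvgn; first exact: nondecreasing_series.
exists (fine (\sum_(t <oo) (weight lam s t)%:E)%E) => _ [n _ <-].
rewrite -lee_fin fineK.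
  rewrite /series /= -sumEFin; apply: nneseries_lim_ge => k _ _.
  by rewrite lee_fin.
rewrite ge0_fin_numE//; apply: nneseries_ge0 => k _ _.
by rewrite lee_fin.
Qed.

(** The time-[t] contribution of the multipliers to the Lagrangian. *)
Definition pen_term a lam x s t : R := beta ^+ t * shockE t s (fun l =>
  \sum_(i < I) lam i (s :: l) (acts a s l) * (disc (g i) a x s l - gbar i)).

Definition pen a lam x s : R := limn (series (pen_term a lam x s)).

(** Slacks are at most [N + M] in absolute value, and the action history generated by [a] is one of
    those summed in [weight], whose other terms are nonnegative. The bound is uniform in [a], which
    later allows a uniform truncation. *)
Lemma pen_term_bound a lam x s t : (forall i h u, 0 <= lam i h u) ->
  `|pen_term a lam x s t| <= (N + M) * weight lam s t.
Proof.
move=> lam0; rewrite normrM ger0_norm ?exprn_ge0// mulrCA.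
rewrite ler_wpM2l ?exprn_ge0//.
apply: le_trans (ler_norm_shockE _ _ _) _.
rewrite mulr_sumr; apply: ler_sum => l _.
pose u0 : t.-tuple A := Tuple (introT eqP
  (etrans (size_acts a s l) (size_tuple l))).
rewrite (bigD1 u0)//= mulrDr ler_wpDr//.
  rewrite mulr_ge0 ?addr_ge0// !sumr_ge0// => u _; rewrite sumr_ge0// => i _.
  by rewrite mulr_ge0 ?pathprob_ge0.
rewrite -mulr_suml mulrA mulrC ler_wpM2r ?pathprob_ge0// mulr_sumr.
apply: (le_trans (ler_norm_sum _ _ _)); apply: ler_sum => i _.
by rewrite normrM ger0_norm// mulrC ler_wpM2r// slack_bound.
Qed.

Lemma pen_cvg a lam x s : Lambda s lam -> cvgn (series (pen_term a lam x s)).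
Proof.
move=> Llam; have cw := weight_cvg _ _ Llam.
apply: dominated_series_cvg (fun t => pen_term_bound a lam x s t Llam.1) _.
exact: (seriesZl_cvg _ _ cw).1.
Qed.

(** The payoff, [gam] and multiplier series converge separately, so the Lagrangian splits term by
    term. *)
Lemma Lagr_split a lam gam x s : Lambda s lam ->
  Lagr a lam gam x s = disc r a x s [::] +
    \sum_(i < I) gam i * disc (g i) a x s [::] + pen a lam x s.
Proof.
move=> Llam; have cp := pen_cvg a lam x s Llam.
have cr : cvgn (series (disc_term r a x s [::])).
  exact: disc_cvg.
pose G (i : 'I_I) n := gam i * disc_term (g i) a x s [::] n.
have cG i : cvgn (series (G i)) /\
    limn (series (G i)) = gam i * disc (g i) a x s [::].
  by apply: seriesZl_cvg; exact: disc_cvg.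
have [csG EsG] := series_sum_cvg _ G (fun i => (cG i).1).
under eq_bigr do rewrite -(cG _).2.
rewrite -EsG /disc -lim_seriesD// -lim_seriesD//; last exact: is_cvg_seriesD.
congr (limn (series _)); apply/funext => n.
rewrite !fctE /G /disc_term /pen_term.
under [in RHS]eq_bigr do rewrite mulrCA -shockEZ.
rewrite -mulr_sumr -shockE_sum -!mulrDr -!shockED.
by [].
Qed.

Lemma pen_ge0 a lam x s : Lambda s lam ->
  feasible_plan pi beta zeta p g gbar x s a -> 0 <= pen a lam x s.
Proof.
move=> Llam [_ fa]; rewrite /pen.
have -> : (0 : R) = limn (series (fun=> 0 : R)).
  apply/esym; rewrite (_ : series _ = cst 0) ?lim_cst//.
  by apply/funext => n; rewrite /series /= big1.
apply: lim_series_le.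
- rewrite (_ : series _ = cst 0); first exact: is_cvg_cst.
  by apply/funext => n; rewrite /series /= big1.
- exact: pen_cvg.
move=> n; rewrite mulr_ge0 ?exprn_ge0// sumr_ge0// => l _.
rewrite mulr_ge0 ?pathprob_ge0// sumr_ge0// => i _.
by rewrite mulr_ge0 ?Llam.1// subr_ge0; exact: fa.
Qed.

Lemma sum_gam_disc_bound gam a x s :
  `|\sum_(i < I) gam i * disc (g i) a x s [::]| <= N * \sum_(i < I) `|gam i|.
Proof.
apply: (le_trans (ler_norm_sum _ _ _)); rewrite mulr_sumr.
by apply: ler_sum => i _; rewrite normrM mulrC ler_wpM2r.
Qed.

Lemma Lambda0 s : Lambda s (fun _ _ _ => 0).
Proof.
split=> //; rewrite eseries0 ?ltry// => t _ _.
by rewrite big1 ?mulr0// => l _; rewrite big1// => u _; rewrite big1// => i _; rewrite mul0r.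
Qed.

Lemma pen0 a x s : pen a (fun _ _ _ => 0) x s = 0.
Proof.
rewrite /pen (_ : series _ = cst 0) ?lim_cst//.
apply/funext => n; rewrite /series /= big1// => t _.
rewrite /pen_term /shockE big1 ?mulr0// => l _.
by rewrite big1 ?mulr0// => i _; rewrite mul0r.
Qed.

(** For a fixed multiplier and plan the Lagrangian moves by at most the stated amount; the estimate
    passes through the supremum and the infimum, whose ranges do not depend on [gam]. *)
Lemma Dval_lipschitz gam gam' x s :
  (Dval gam' x s <= Dval gam x s +
     (N * \sum_(i < I) `|gam' i - gam i|)%:E)%E.
Proof.
rewrite -leeBlDr//; apply: le_ereal_inf_tmp => _ [lam Llam <-].
rewrite leeBlDr//; apply: ge_ereal_inf.
exists (ereal_sup [set (Lagr a lam gam' x s)%:E | a in tAinf zeta p x s]).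
  by exists lam.
apply: ge_ereal_sup => _ [a ta <-].
apply: (@le_trans _ _ ((Lagr a lam gam x s)%:E +
   (N * \sum_(i < I) `|gam' i - gam i|)%:E)%E); last first.
  by rewrite leeD2r//; apply: ereal_sup_ubound; exists a.
rewrite -EFinD lee_fin !Lagr_split// [leRHS]addrAC lerD2r -addrA lerD2l.
rewrite -lerBlDl -sumrB; under eq_bigr do rewrite -mulrBl.
exact: (le_trans (ler_norm _) (sum_gam_disc_bound (fun i => gam' i - gam i) _ _ _)).
Qed.

Hypothesis feasible_exists : forall x s,
  exists a, feasible_plan pi beta zeta p g gbar x s a.

(** From below, a feasible plan has a nonnegative penalty under every multiplier. From above, the
    zero multiplier leaves only bounded values. *)
Lemma Dval_fin_num gam x s : Dval gam x s \is a fin_num.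
Proof.
pose C := N + N * \sum_(i < I) `|gam i|.
rewrite fin_numElt; apply/andP; split.
  apply: (@lt_le_trans _ _ (- C)%:E); first exact: ltNyr.
  apply: le_ereal_inf_tmp => _ [lam Llam <-].
  have [a fa] := feasible_exists x s.
  apply: (@le_trans _ _ (Lagr a lam gam x s)%:E); last first.
    by apply: ereal_sup_ubound; exists a => //; exact: fa.1.
  rewrite lee_fin Lagr_split// opprD ler_wpDr ?pen_ge0//.
  apply: lerD; first by have := disc_r a x s [::]; rewrite ler_norml => /andP[].
  by have := sum_gam_disc_bound gam a x s; rewrite ler_norml => /andP[].
apply: (@le_lt_trans _ _ C%:E); last exact: ltry.
apply: ge_ereal_inf.
exists (ereal_sup [set (Lagr a (fun _ _ _ => 0) gam x s)%:E | a in tAinf zeta p x s]).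
  by exists (fun _ _ _ => 0) => //; exact: Lambda0.
apply: ge_ereal_sup => _ [a ta <-].
rewrite lee_fin Lagr_split ?pen0 ?addr0; last exact: Lambda0.
apply: lerD; first exact: le_trans (ler_norm _) (disc_r _ _ _ _).
exact: le_trans (ler_norm _) (sum_gam_disc_bound _ _ _ _).
Qed.

End dual_value.

(** * Expected penalties under a feasible lottery *)

Section lottery.
Variables (a0 : A) (P : probability (planM S a0) R) (x : X) (s : S).
Hypothesis P_feasible : lottery_feasible pi beta zeta p g gbar a0 P x s.

Lemma slack_measurable i l :
  measurable_fun setT (fun a : planM S a0 => disc (g i) a x s l - gbar i).
Proof.
by apply: measurable_funB => //; exact: measurable_disc.
Qed.

Lemma slack_integrable i l :
  P.-integrable setT (EFin \o (fun a : planM S a0 => disc (g i) a x s l - gbar i)).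
Proof.
apply: bounded_probability_integrable; first exact: slack_measurable.
by move=> a; exact: slack_bound.
Qed.

(** An indicator factor turns the feasibility integral over one history into an expectation over all
    plans, ready for linear combination. *)
Lemma slack_on_history i l u : size u = size l ->
  expect_ge P 0 (fun a : planM S a0 =>
    (acts a s l == u)%:R * (disc (g i) a x s l - gbar i)).
Proof.
move=> ul; pose D : set (planM S a0) := [set a | acts a s l = u].
have mD : measurable D by exact: measurable_acts.
have E : (fun a : planM S a0 =>
    ((acts a s l == u)%:R * (disc (g i) a x s l - gbar i))%:E) =
  (EFin \o (fun a : planM S a0 => disc (g i) a x s l - gbar i)) \_ D.
  apply/funext => a; rewrite patchE; case: eqP => au.
    by rewrite mem_set// mul1r.
  by rewrite memNset// mul0r.
split.
  rewrite (_ : _ \o _ = (EFin \o (fun a : planM S a0 => disc (g i) a x s l - gbar i)) \_ D) //.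
  apply/integrable_restrict => //; rewrite setTI.
  by apply: integrableS (slack_integrable i l).
rewrite E -integral_mkcond.
exact: P_feasible.2.
Qed.

(** The multiplier sees the random plan only through its first action and the action history of the
    continuation. Splitting over the finitely many values of both leaves nonnegative constants times
    slacks on a fixed history, each of nonnegative expectation. *)
Lemma continuation_pen_expect_ge0 (lam : A -> 'I_I -> seq S -> seq A -> R) s' t :
  (forall b i h u, 0 <= lam b i h u) ->
  expect_ge P 0 (fun a : planM S a0 => pen_term
    (continuation a s) (lam (a [:: s])) (zeta x (a [:: s]) s) s' t).
Proof.
move=> lam0.
apply: expect_ge0Z; first exact: exprn_ge0.
apply: expect_ge0_sum => l; apply: expect_ge0Z; first exact: pathprob_ge0.
apply: expect_ge0_sum => i.
have -> : (fun a : planM S a0 => lam (a [:: s]) i (s' :: l)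
    (acts (continuation a s) s' l) *
    (disc (g i) (continuation a s) (zeta x (a [:: s]) s) s' l - gbar i)) =
  (fun a => \sum_(b : A) \sum_(u : t.-tuple A) lam b i (s' :: l) u *
    ((acts a s (s' :: l) == b :: u)%:R *
     (disc (g i) a x s (s' :: l) - gbar i))).
  apply/funext => a; rewrite disc_continuation acts_continuation.
  rewrite (bigD1 (a [:: s]))//= [X in _ = _ + X]big1 ?addr0; last first.
    move=> b ba; rewrite big1// => u _.
    by rewrite eqseq_cons eq_sym (negbTE ba) mul0r mulr0.
  pose u0 : t.-tuple A := Tuple (introT eqP
    (etrans (size_acts (continuation a s) s' l) (size_tuple l))).
  rewrite (bigD1 u0)//= big1 ?addr0; last first.
    move=> u uu0; rewrite eqseq_cons eqxx /=.
    rewrite (_ : _ == _ = false) ?mul0r ?mulr0//.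
    by apply/negbTE; rewrite eq_sym.
  by rewrite eqxx mul1r.
apply: expect_ge0_sum => b; apply: expect_ge0_sum => u.
apply: expect_ge0Z => //; apply: slack_on_history.
by rewrite /= !size_tuple.
Qed.

End lottery.

(** * Finiteness, Lipschitz bound and coercivity of [Phi] *)

Hypothesis feasible_exists : forall x s,
  exists a, feasible_plan pi beta zeta p g gbar x s a.
Implicit Types lam : 'I_I -> R.

Let Dval_fin gam x s : Dval gam x s \is a fin_num.
Proof. exact: (Dval_fin_num feasible_exists). Qed.

Definition Phi_branch gam lam x s b : R :=
  r x b s + \sum_(i < I) (gam i * g i x b s + lam i * (g i x b s - gbar i)) +
  beta * \sum_(s' : S) pi s s' *
    fine (Dval (fun i => gam i + lam i) (zeta x b s) s').

Lemma PhiE gam lam x s :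
  Phi gam lam x s =
  ereal_sup [set (Phi_branch gam lam x s b)%:E | b in [set b | 0 <= p x b s]].
Proof.
congr ereal_sup; apply: eq_imagel => b _.
rewrite /Phi_branch [RHS]EFinD; congr (_ + _)%E.
rewrite EFinM -sumEFin; congr (_ * _)%E; apply: eq_bigr => s' _.
by rewrite EFinM fineK.
Qed.

Lemma Phi_branch_le gam lam x s b : 0 <= p x b s ->
  ((Phi_branch gam lam x s b)%:E <= Phi gam lam x s)%E.
Proof. by move=> pb; rewrite PhiE; apply: ereal_sup_ubound; exists b. Qed.

(** A feasible plan supplies an admissible first action, and [A] is finite. *)
Lemma Phi_fin_num gam lam x s : Phi gam lam x s \is a fin_num.
Proof.
have [a [ta _]] := feasible_exists x s.
rewrite fin_numElt; apply/andP; split.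
  by apply: lt_le_trans (Phi_branch_le _ _ _ _ _ (ta [::])); exact: ltNyr.
rewrite PhiE.
apply: (@le_lt_trans _ _ (\sum_b `|Phi_branch gam lam x s b|)%:E).
  apply: ge_ereal_sup => _ [b _ <-]; rewrite lee_fin.
  by rewrite (bigD1 b)//= ler_wpDr ?ler_norm// sumr_ge0.
exact: ltry.
Qed.

(** On each action, [M + M] bounds [g - gbar], and [N] comes from [Dval], averaged over the next
    shock and discounted by [beta < 1]. *)
Lemma Phi_lipschitz gam lam lam' x s :
  fine (Phi gam lam' x s) <= fine (Phi gam lam x s) +
    (M + M + N) * \sum_(i < I) `|lam' i - lam i|.
Proof.
rewrite -lee_fin fineK ?Phi_fin_num// [X in (X <= _)%E]PhiE.
apply: ge_ereal_sup => _ [b pb <-]; rewrite [leRHS]EFinD fineK ?Phi_fin_num//.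
apply: (@le_trans _ _ ((Phi_branch gam lam x s b)%:E +
    ((M + M + N) * \sum_(i < I) `|lam' i - lam i|)%:E)%E); last first.
  by rewrite leeD2r// Phi_branch_le.
rewrite -EFinD lee_fin mulrDl addrACA /Phi_branch; apply: lerD.
  rewrite -addrA lerD2l -lerBlDl -sumrB mulr_sumr ler_sum// => i _.
  rewrite (_ : _ - _ = (lam' i - lam i) * (g i x b s - gbar i)); last by ring.
  apply: le_trans (ler_norm _) _; rewrite normrM mulrC ler_wpM2r//.
  by rewrite (le_trans (ler_normB _ _))// lerD.
apply: (@le_trans _ _ (beta * (\sum_(s' : S) pi s s' *
    fine (Dval (fun i => gam i + lam i) (zeta x b s) s') +
    N * \sum_(i < I) `|lam' i - lam i|))).
  rewrite ler_wpM2l//.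
  rewrite -[X in _ <= _ + X]mul1r -(pi_sum1 s) mulr_suml -big_split ler_sum//=.
  move=> s' _; rewrite -mulrDr ler_wpM2l//.
  rewrite -lee_fin EFinD !fineK//.
  have := Dval_lipschitz (fun i => gam i + lam i) (fun i => gam i + lam' i)
    (zeta x b s) s'.
  rewrite [in X in X -> _](eq_bigr (fun i => `|lam' i - lam i|))// => i _.
  by rewrite opprD addrACA subrr add0r.
rewrite mulrDr lerD2l ler_piMl//; last by case/andP: beta01 => _ /ltW.
by rewrite mulr_ge0// sumr_ge0.
Qed.

Lemma near_optimal_multiplier gam x s (e : R) : 0 < e ->
  exists2 nu, Lambda s nu & forall a, tAinf zeta p x s a ->
    Lagr a nu gam x s <= fine (Dval gam x s) + e.
Proof.
move=> e0; have [_ [nu Lnu <-] nuD] := lb_ereal_inf_adherent e0 (Dval_fin gam x s).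
exists nu => // a ta; rewrite -lee_fin EFinD fineK//.
by apply: le_trans (ltW nuD); apply: ereal_sup_ubound; exists a.
Qed.

Lemma Phi_coercive (a0 : A) gam lam x s (P : probability (planM S a0) R) eps :
  (forall i, 0 <= lam i) ->
  lottery_feasible pi beta zeta p g gbar a0 P x s ->
  (forall i : 'I_I, (eps%:E <= \int[P]_(a in [set: planM S a0])
     (cont pi beta zeta g a x s i [::] - gbar i)%:E)%E) ->
  eps * \sum_(i < I) lam i <=
  fine (Phi gam lam x s) + (N + N * \sum_(i < I) `|gam i|).
Proof.
move=> lam0 feasP slaterP; apply/ler_addgt0Pr => e e0.
(* One half of [e] pays for near-optimality of the multipliers, the other for truncating the
   penalties. *)
pose d := e / 2; have d0 : 0 < d by rewrite divr_gt0.
pose gl i := gam i + lam i.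
(* One multiplier per first action and next shock: the family is finite, so a single summable
   sequence dominates all its weights. *)
have /choice[nu0 nu0P] (q : A * S) : exists nu, Lambda q.2 nu /\
    forall a, tAinf zeta p (zeta x q.1 s) q.2 a ->
      Lagr a nu gl (zeta x q.1 s) q.2 <=
      fine (Dval gl (zeta x q.1 s) q.2) + d.
  by have [nu h1 h2] := near_optimal_multiplier gl (zeta x q.1 s) q.2 _ d0; exists nu.
pose nu b s' := nu0 (b, s').
have Lnu b s' : Lambda s' (nu b s') by exact: (nu0P (b, s')).1.
have nu_opt b s' a : tAinf zeta p (zeta x b s) s' a ->
    Lagr a (nu b s') gl (zeta x b s) s' <=
    fine (Dval gl (zeta x b s) s') + d by exact: (nu0P (b, s')).2.
(* a single summable bound on the penalty terms, uniform in the plan *)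
pose v t := (N + M) * \sum_(q : A * S) weight (nu q.1 q.2) q.2 t.
have cv : cvgn (series v).
  apply: (seriesZl_cvg _ _ _).1.
  apply: (series_sum_cvg _ (fun (q : A * S) => weight (nu q.1 q.2) q.2) _).1.
  by move=> q; exact: weight_cvg.
pose penT a b s' t := pen_term a (nu b s') (zeta x b s) s' t.
have pen_v a b s' t : `|penT a b s' t| <= v t.
  apply: le_trans (pen_term_bound _ _ _ _ _ (Lnu b s').1) _.
  rewrite ler_wpM2l ?addr_ge0// (bigD1 (b, s'))//= ler_wpDr// sumr_ge0// => q _.
  exact: weight_ge0 (Lnu _ _).1.
have [T tailT] : exists T, limn (series v) - series v T <= d.
  have /cvgrPdist_le/(_ _ d0)[T _ hT] : series v n @[n --> \oo] --> limn (series v) by [].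
  exists T; have := hT T (leqnn T); exact: le_trans (ler_norm _).
(* The slack of the whole plan priced by [lam], plus the truncated continuation penalties. *)
pose F (a : planM S a0) := \sum_(i < I) lam i * (disc (g i) a x s [::] - gbar i) +
  beta * \sum_(s' : S) pi s s' *
    \sum_(0 <= t < T) penT (continuation a s) (a [:: s]) s' t.
have F_ge : expect_ge P (eps * \sum_(i < I) lam i) F.
  rewrite -[eps * _]addr0; apply: expect_geD.
    rewrite mulrC mulr_suml; apply: expect_ge_sum => i.
    apply: expect_geZ => //; split; last exact: slaterP.
    exact: slack_integrable.
  apply: expect_ge0Z => //; apply: expect_ge0_sum => s'.
  apply: expect_ge0Z => //; apply: expect_ge0_sum => t.
  apply: (continuation_pen_expect_ge0 a0 P x s feasP (fun b => nu b s')).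
  by move=> b; exact: (Lnu b s').1.
(* The expectation of [F] is at least the left side, so it remains to bound [F] from above on each
   admissible plan. *)
apply: (expect_ge_le P _ _ F _ (measurable_tAinf a0 X zeta p x s) feasP.1 F_ge).
move=> a ta.
pose b := a [:: s].
have pb : 0 <= p x b s := ta [::].
have branch := Phi_branch_le gam lam x s b pb.
rewrite -[X in (_ <= X)%E]fineK ?Phi_fin_num// lee_fin in branch.
(* Near-optimality bounds the full Lagrangian of the continuation up to [d]; dropping the penalty
   tail costs another [d]. *)
have cont_le s' : disc r (continuation a s) (zeta x b s) s' [::] +
    \sum_(i < I) gl i * disc (g i) (continuation a s) (zeta x b s) s' [::] +
    \sum_(0 <= t < T) penT (continuation a s) b s' t <=
    fine (Dval gl (zeta x b s) s') + e.
  have ta' := tAinf_continuation zeta R p a x s s' ta.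
  have := nu_opt b s' _ ta'.
  rewrite Lagr_split//.
  have := dominated_series_tail _ v T (pen_v (continuation a s) b s') cv.
  rewrite -/(pen _ _ _ _) {1}/series/=.
  have -> : e = d + d by rewrite /d; lra.
  by move: tailT; lra.
have disc_r_rec : disc r a x s [::] = r x b s + beta * \sum_(s' : S) pi s s' *
    disc r (continuation a s) (zeta x b s) s' [::].
  exact: (disc_rec r M).
have disc_g_rec i : disc (g i) a x s [::] = g i x b s + beta *
    \sum_(s' : S) pi s s' *
    disc (g i) (continuation a s) (zeta x b s) s' [::].
  exact: (disc_rec (g i) M).
have total : F a + (disc r a x s [::] + \sum_(i < I) gam i * disc (g i) a x s [::])
    <= Phi_branch gam lam x s b + e.
  have le_sum : beta * \sum_(s' : S) pi s s' *
      (disc r (continuation a s) (zeta x b s) s' [::] +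
       \sum_(i < I) gl i * disc (g i) (continuation a s) (zeta x b s) s' [::] +
       \sum_(0 <= t < T) penT (continuation a s) b s' t) <=
      beta * \sum_(s' : S) pi s s' * fine (Dval gl (zeta x b s) s') + e.
    apply: (@le_trans _ _ (beta * (\sum_(s' : S) pi s s' *
        fine (Dval gl (zeta x b s) s') + e))).
      rewrite ler_wpM2l// -[X in _ <= _ + X]mul1r -(pi_sum1 s) mulr_suml.
      rewrite -big_split ler_sum//= => s' _.
      by rewrite -mulrDr ler_wpM2l.
    rewrite mulrDr lerD2l ler_piMl//; first exact: ltW.
    by case/andP: beta01 => _ /ltW.
  have sum_split : \sum_(s' : S) pi s s' *
      (disc r (continuation a s) (zeta x b s) s' [::] +
       \sum_(i < I) gl i * disc (g i) (continuation a s) (zeta x b s) s' [::] +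
       \sum_(0 <= t < T) penT (continuation a s) b s' t) =
      \sum_(s' : S) pi s s' * disc r (continuation a s) (zeta x b s) s' [::] +
      \sum_(i < I) gl i * (\sum_(s' : S) pi s s' *
        disc (g i) (continuation a s) (zeta x b s) s' [::]) +
      \sum_(s' : S) pi s s' * \sum_(0 <= t < T) penT (continuation a s) b s' t.
    under eq_bigr do rewrite !mulrDr; rewrite !big_split /=; congr (_ + _ + _).
    under eq_bigr do rewrite mulr_sumr; rewrite exchange_big /=.
    by apply: eq_bigr => i _; rewrite mulr_sumr; apply: eq_bigr => s' _; rewrite mulrCA.
  (* Continuation values carry the weight [gl = gam + lam]; the recursion for [g] regroups them with
     the current payoffs into the [gam] value and the [lam] slack of the whole plan. *)
  have sum_g : \sum_(i < I) lam i * (disc (g i) a x s [::] - gbar i) +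
      \sum_(i < I) gam i * disc (g i) a x s [::] =
      \sum_(i < I) (gam i * g i x b s + lam i * (g i x b s - gbar i)) +
      beta * \sum_(i < I) gl i * (\sum_(s' : S) pi s s' *
        disc (g i) (continuation a s) (zeta x b s) s' [::]).
    rewrite mulr_sumr -!big_split; apply: eq_bigr => i _ /=.
    by rewrite disc_g_rec /gl; ring.
  by move: le_sum; rewrite sum_split /F -/b disc_r_rec /Phi_branch -/gl !mulrDr; lra.
have abs_r : - N <= disc r a x s [::].
  have := disc_bound r M r_bdd a x s [::].
  by rewrite ler_norml => /andP[].
have abs_g : - (N * \sum_(i < I) `|gam i|) <=
    \sum_(i < I) gam i * disc (g i) a x s [::].
  have := sum_gam_disc_bound gam a x s.
  by rewrite ler_norml => /andP[].
lra.
Qed.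

End recursive_contract.

(** * Existence of a minimising multiplier *)

Theorem theorem5p1
  (R : realType) (S A : finType) (X : countType) (I : nat)
  (pi : S -> S -> R) (beta : R)
  (zeta : X -> A -> S -> X) (p r : X -> A -> S -> R)
  (g : 'I_I -> X -> A -> S -> R) (gbar : 'I_I -> R) (a0 : A)
  (pi_pos : forall s s' : S, 0 < pi s s')
  (pi_sum1 : forall s : S, \sum_(s' : S) pi s s' = 1)
  (beta_pos : 0 < beta) (beta_lt1 : beta < 1)
  (r_bdd : exists M : R, forall x a s, `|r x a s| <= M)
  (g_bdd : exists M : R, forall i x a s, `|g i x a s| <= M)
  (feasible_exists : forall (x0 : X) (s0 : S),
     exists a : seq S -> A, feasible_plan pi beta zeta p g gbar x0 s0 a)
  (slater : exists eps : R, 0 < eps /\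
     forall (s0 : S) (x0 : X),
       exists P : probability (planM S a0) R,
         lottery_feasible pi beta zeta p g gbar a0 P x0 s0 /\
         forall i : 'I_I,
           (eps%:E <= \int[P]_(a in [set: planM S a0])
                        (cont pi beta zeta g a x0 s0 i [::] - gbar i)%:E)%E) :
  forall (x : X) (s : S) (gam : 'I_I -> R), (forall i, 0 <= gam i) ->
    exists lamstar : 'I_I -> R,
      (forall i, 0 <= lamstar i) /\
      Phi pi beta zeta p r g gbar gam lamstar x s =
      ereal_inf [set Phi pi beta zeta p r g gbar gam lam x s
                | lam in [set lam : 'I_I -> R | forall i, 0 <= lam i]].
Proof.
move=> x s gam _.
have [Mr Mr_bdd] := r_bdd; have [Mg Mg_bdd] := g_bdd.
have [eps [eps0 /(_ s x)[P [feasP slaterP]]]] := slater.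
(* One constant dominates [r], [g] and [gbar]; the absolute values make it nonnegative. *)
pose M := `|Mr| + `|Mg| + \sum_(i < I) `|gbar i|.
have M_ge0 : 0 <= M by rewrite !addr_ge0// sumr_ge0.
have rM y b c : `|r y b c| <= M.
  rewrite (le_trans (Mr_bdd _ _ _))// (le_trans (ler_norm _))// /M -addrA.
  by rewrite lerDl addr_ge0// sumr_ge0.
have gM i y b c : `|g i y b c| <= M.
  rewrite (le_trans (Mg_bdd _ _ _ _))// (le_trans (ler_norm _))// /M addrAC.
  by rewrite lerDr addr_ge0// sumr_ge0.
have gbarM i : `|gbar i| <= M.
  rewrite /M (bigD1 i)//= addrCA lerDl !addr_ge0// sumr_ge0//.
have pi_ge0 s1 s2 : 0 <= pi s1 s2 by exact: ltW.
have beta01 : 0 < beta < 1 by apply/andP.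
have fin_Phi lam : Phi pi beta zeta p r g gbar gam lam x s \is a fin_num.
  exact: (Phi_fin_num pi beta zeta p r g gbar M).
have N_ge0 : 0 <= M / (1 - beta) by rewrite divr_ge0// subr_ge0 ltW.
(* The Slater constant [eps] is the coercivity rate; the order [v u] fits the orientation of the
   Lipschitz bound. *)
have [lam [lam0 lam_min]] := lipschitz_coercive_min _
  (fun lam => fine (Phi pi beta zeta p r g gbar gam lam x s)) _ eps _
  (addr_ge0 (addr_ge0 M_ge0 M_ge0) N_ge0) eps0
  (fun u v => Phi_lipschitz pi beta zeta p r g gbar M pi_ge0 pi_sum1
     beta01 M_ge0 rM gM gbarM feasible_exists gam v u x s)
  (fun u u0 => Phi_coercive pi beta zeta p r g gbar M pi_ge0 pi_sum1
     beta01 M_ge0 rM gM gbarM feasible_exists a0 gam u x s P eps u0 feasP slaterP).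
exists lam; split=> //.
exact: (ereal_inf_attained (fun lam => Phi pi beta zeta p r g gbar gam lam x s)).
Qed.
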